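(* Let $X\in\mathbb{R}^{m\times n}_+$, and let $X=WH$ with $W\in\mathbb{R}^{m\times r}$, $H\in\mathbb{R}^{r\times n}_+$, satisfy the facet-based conditions (FBC) for some parameter $s$. Then for any other factorization $X=\hat W\hat H$ (with $\hat W\in\mathbb{R}^{m\times r}$, $\hat H\in\mathbb{R}^{r\times n}_+$) satisfying the FBC (for some, possibly different, parameter $\hat s$), we have $\hat W=W\Pi$ for some permutation matrix $\Pi\in\{0,1\}^{r\times r}$.
   Context: For a matrix $M$, $\operatorname{conv}(M)$ denotes the convex hull of its columns. A facet of a polytope is a face of dimension one less than the dimension of the polytope. The unit simplex is $\Delta^r=\{x\in\mathbb{R}^r: x\ge 0,\ \sum_i x_i=1\}$. Facet-based conditions (FBC) with parameter $s$ for $X=WH$, where $d=\operatorname{rank}(X)$: (a) no column of $W$ lies in the convex hull of the other columns of $W$ (so $\operatorname{conv}(W)$ is a polytope whose $r$ vertices are the columns of $W$); (b) $H(:,j)\in\Delta^r$ for all $j=1,\dots,n$; (c) each facet of $\operatorname{conv}(W)$ contains at least $s\ge d$ distinct columns of $X$, and among them at least $d-1$ generate that facet (i.e., the convex hull of these $s$ columns has dimension $d-2$); (d) every facet of $\operatorname{conv}(X)$ which is not a facet of $\operatorname{conv}(W)$ contains strictly fewer than $s$ distinct columns of $X$. *)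

(* Defs.v *)
From mathcomp Require Import all_boot all_order all_algebra all_fingroup.
Set Implicit Arguments. Unset Strict Implicit. Unset Printing Implicit Defensive.
Import Order.TTheory GRing.Theory Num.Theory.
Local Open Scope ring_scope.

Section Geometry.
Variable R : realFieldType.

Definition nonneg_mx (p q : nat) (M : 'M[R]_(p, q)) : Prop :=
  forall i j, 0 <= M i j.

Definition in_simplex (k : nat) (h : 'cV[R]_k) : Prop :=
  (forall i, 0 <= h i 0) /\ \sum_i h i 0 = 1.

Definition conv (p k : nat) (M : 'M[R]_(p, k)) : 'cV[R]_p -> Prop :=
  fun x => exists h : 'cV[R]_k, in_simplex h /\ x = M *m h.

Definition conv_sub (p k : nat) (M : 'M[R]_(p, k)) (J : {set 'I_k})
  : 'cV[R]_p -> Prop :=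
  fun x => exists h : 'cV[R]_k,
    in_simplex h /\ (forall i, i \notin J -> h i 0 = 0) /\ x = M *m h.

Definition aff_indep (p k : nat) (P : 'M[R]_(p, k.+1)) : bool :=
  \rank (\matrix_(i < p, j < k) (P i (lift ord0 j) - P i ord0)) == k.

Definition affdim_nat (p : nat) (S : 'cV[R]_p -> Prop) (k : nat) : Prop :=
  (exists P : 'M[R]_(p, k.+1), (forall j, S (col j P)) /\ aff_indep P) /\
  (forall P : 'M[R]_(p, k.+2), (forall j, S (col j P)) -> ~~ aff_indep P).

Definition has_dim (p : nat) (S : 'cV[R]_p -> Prop) (k : int) : Prop :=
  (k = -1 /\ forall x, ~ S x) \/ (exists k' : nat, k = k'%:Z /\ affdim_nat S k').

Definition is_face (p : nat) (P F : 'cV[R]_p -> Prop) : Prop :=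
  exists (a : 'rV[R]_p) (b : R),
    (forall x, P x -> (a *m x) 0 0 <= b) /\
    (forall x, F x <-> (P x /\ (a *m x) 0 0 = b)).

Definition is_facet (p : nat) (P F : 'cV[R]_p -> Prop) : Prop :=
  is_face P F /\ exists dP : int, has_dim P dP /\ has_dim F (dP - 1).

Definition distinct_cols_in (p n : nat) (X : 'M[R]_(p, n))
  (F : 'cV[R]_p -> Prop) (J : {set 'I_n}) : Prop :=
  (forall j, j \in J -> F (col j X)) /\
  {in J &, forall j j', col j X = col j' X -> j = j'}.

Definition FBC (p n r : nat) (X : 'M[R]_(p, n)) (W : 'M[R]_(p, r))
  (H : 'M[R]_(r, n)) (s : nat) : Prop :=
  let d : int := (\rank X)%:Z in
  (forall j : 'I_r, ~ (exists h : 'cV[R]_r,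
        in_simplex h /\ h j 0 = 0 /\ col j W = W *m h)) /\
  (forall j : 'I_n, in_simplex (col j H)) /\
  (d <= s%:Z /\
   forall F, is_facet (conv W) F ->
     exists J : {set 'I_n}, distinct_cols_in X F J /\ (s <= #|J|)%N /\
       has_dim (conv_sub X J) (d - 2)) /\
  (forall F, is_facet (conv X) F -> ~ is_facet (conv W) F ->
     forall J : {set 'I_n}, distinct_cols_in X F J -> (#|J| < s)%N).

End Geometry.

(* Main.v *)
(* Condition (d) compares facets as sets, and it forces conv(X) = conv(W); since the
   columns of W are in convex position they are then the vertices of conv(X), and two
   such matrices differ by a permutation.

   To see that conv(W) is contained in conv(X), homogenize points as rows (x, 1), so that
   affine functions become linear forms and affine dimensions become ranks minus one.
   A facet of conv(X) with s distinct columns is a facet of conv(W) by (d), so its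
   equation is valid on conv(W) and conv(X), conv(W) have the same dimension.
   Let phi define a facet of conv(W); by (c) it contains s columns, of affine dimension
   d - 2, so its trace K on conv(X) is a face of
   codimension at most 2, as conv(X) has dimension d - 1 or d. In codimension 1, K is a
   facet of conv(X), hence the facet phi = 0 of conv(W). Codimension 2 is impossible:
   rotating phi about K gives two distinct facets of conv(X) through K, with equations psi
   and f, both also facets of conv(W), and f = a phi + b psi there with a > 0 and b >= 0,
   so that f vanishes on conv(X) only where phi does, that is on K. Finally every column
   of W lies on a facet of conv(W), by Farkas' lemma and rotation. *)
Require Import Defs.
From Stdlib Require Import Classical.
From mathcomp Require Import all_boot all_order all_algebra all_fingroup.
From mathcomp Require Import zify lra.
Import Order.TTheory GRing.Theory Num.Theory.
Local Open Scope ring_scope.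

Set Implicit Arguments.
Unset Strict Implicit.
Unset Printing Implicit Defensive.

Section FacetBasedUniqueness.
Variable R : realFieldType.

(** * Linear forms on the rows of a matrix *)

(** Zeroing the other rows, instead of extracting a submatrix, keeps the size independent of [Z] and
    leaves the span of the chosen rows unchanged. *)
Definition rows_on k N (Z : {set 'I_k}) (M : 'M[R]_(k, N)) : 'M[R]_(k, N) :=
  \matrix_(i, j) (if i \in Z then M i j else 0).

Definition valid k N (M : 'M[R]_(k, N)) (phi : 'cV[R]_N) : Prop :=
  forall i, (M *m phi) i 0 <= 0.

Definition zeros k N (M : 'M[R]_(k, N)) (phi : 'cV[R]_N) : {set 'I_k} :=
  [set i | (M *m phi) i 0 == 0].

(* [phi] vanishes on a subset of the rows whose rank is one less than that of [M]; the
   homogenized empty set has rank 0, matching dimension -1. *)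
Definition facet_form k N (M : 'M[R]_(k, N)) (phi : 'cV[R]_N) : Prop :=
  valid M phi /\ (\rank (rows_on (zeros M phi) M)).+1 = \rank M.

Lemma row_rows_on k N (Z : {set 'I_k}) (M : 'M[R]_(k, N)) i :
  row i (rows_on Z M) = if i \in Z then row i M else 0.
Proof. by apply/rowP=> j; case: ifP => Zi; rewrite !mxE Zi. Qed.

Lemma rows_on_subP k N q (Z : {set 'I_k}) (M : 'M[R]_(k, N)) (B : 'M[R]_(q, N)) :
  reflect (forall i, i \in Z -> (row i M <= B)%MS) (rows_on Z M <= B)%MS.
Proof.
apply: (iffP row_subP) => sMB i; first by move=> Zi; have := sMB i; rewrite row_rows_on Zi.
by rewrite row_rows_on; case: ifP => [/sMB|_] //; apply: sub0mx.
Qed.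

Lemma row_sub_rows_on k N (Z : {set 'I_k}) (M : 'M[R]_(k, N)) i :
  i \in Z -> (row i M <= rows_on Z M)%MS.
Proof. by move/(rows_on_subP _ _ (rows_on Z M)): (submx_refl (rows_on Z M)); apply. Qed.

Lemma rows_on_sub k N (Z : {set 'I_k}) (M : 'M[R]_(k, N)) : (rows_on Z M <= M)%MS.
Proof. by apply/rows_on_subP => i _; apply: row_sub. Qed.

Lemma rows_onS k N (Y Z : {set 'I_k}) (M : 'M[R]_(k, N)) :
  Y \subset Z -> (rows_on Y M <= rows_on Z M)%MS.
Proof. by move=> /subsetP sYZ; apply/rows_on_subP => i /sYZ; apply: row_sub_rows_on. Qed.

Lemma row_form k N (M : 'M[R]_(k, N)) (phi : 'cV[R]_N) i :
  (row i M *m phi) 0 0 = (M *m phi) i 0.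
Proof. by rewrite -row_mul mxE. Qed.

Lemma row_form_eq0 k N (M : 'M[R]_(k, N)) (phi : 'cV[R]_N) i :
  (row i M *m phi == 0) = (i \in zeros M phi).
Proof.
rewrite inE -row_form; apply/eqP/eqP => [->|e]; first by rewrite mxE.
by apply/matrixP => a b; rewrite !ord1 e mxE.
Qed.

Lemma zerosP k N (M : 'M[R]_(k, N)) (phi : 'cV[R]_N) (Z : {set 'I_k}) :
  reflect (rows_on Z M *m phi = 0) (Z \subset zeros M phi).
Proof.
apply: (iffP subsetP) => [sZ|e i Zi].
  apply/row_matrixP => i; rewrite row_mul row_rows_on row0; case: ifP => [/sZ|_].
    by rewrite -row_form_eq0 => /eqP.
  by rewrite mul0mx.
by rewrite -row_form_eq0; move/(congr1 (row i))/eqP: e; rewrite row_mul row_rows_on Zi row0.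
Qed.

Lemma mul_rows_on_zeros k N (M : 'M[R]_(k, N)) (phi : 'cV[R]_N) :
  rows_on (zeros M phi) M *m phi = 0.
Proof. exact/zerosP. Qed.

Lemma submx_form_eq0 p q N (A : 'M[R]_(p, N)) (B : 'M[R]_(q, N)) (phi : 'cV[R]_N) :
  (A <= B)%MS -> B *m phi = 0 -> A *m phi = 0.
Proof. by case/submxP => D -> e; rewrite -mulmxA e mulmx0. Qed.

Lemma rank_rows_on_zeros k N (M : 'M[R]_(k, N)) (phi : 'cV[R]_N) i :
  (M *m phi) i 0 != 0 -> (\rank (rows_on (zeros M phi) M) < \rank M)%N.
Proof.
move=> ne0; apply: rank_ltmx; rewrite ltmxE rows_on_sub /=; apply/negP => sM.
by case/negP: ne0; rewrite (submx_form_eq0 sM) ?mul_rows_on_zeros // mxE.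
Qed.

(** Since [phi] is zero on [S] but not at [x], the rank bound makes [S] and [x] together span [M]; a
    suitable [psi - l *: phi] vanishes on both. *)
Lemma forms_proportional p q N (S : 'M[R]_(p, N)) (M : 'M[R]_(q, N)) (x : 'rV[R]_N)
    (phi psi : 'cV[R]_N) :
  (S <= M)%MS -> (\rank M <= (\rank S).+1)%N -> (x <= M)%MS ->
  S *m phi = 0 -> S *m psi = 0 -> (x *m phi) 0 0 != 0 ->
  M *m psi = ((x *m psi) 0 0 / (x *m phi) 0 0) *: (M *m phi).
Proof.
move=> sSM rM sxM S0 S0' xn0.
set l := _ / _.
have nsx : ~~ (x <= S)%MS.
  by apply/negP => /submx_form_eq0 /(_ S0) e; rewrite e mxE eqxx in xn0.
have sM : (M <= S + x)%MS.
  rewrite -(mxrank_leqif_sup (_ : (S + x <= M)%MS)) ?addsmx_sub ?sSM //.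
  rewrite eqn_leq; apply/andP; split; first by apply: mxrankS; rewrite addsmx_sub sSM.
  apply: (leq_trans rM); apply: rank_ltmx.
  by rewrite ltmxE addsmxSl /= addsmx_sub submx_refl.
suff : M *m (psi - l *: phi) = 0.
  by rewrite mulmxBr -scalemxAr => /eqP; rewrite subr_eq0 => /eqP.
apply: submx_form_eq0 sM _; apply/eqP.
have sub_kermx0 : forall a (C : 'M[R]_(a, N)) (f : 'cV[R]_N), (C *m f == 0) = (C <= kermx f)%MS.
  by move=> a C f; apply/eqP/sub_kermxP.
rewrite sub_kermx0 addsmx_sub -!sub_kermx0 !mulmxBr -!scalemxAr S0 S0' scaler0 subr0 eqxx /=.
rewrite [x *m psi]mx11_scalar [in l *: _](mx11_scalar (x *m phi)) scale_scalar_mx.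
by rewrite /l divfK // subrr.
Qed.

(* Induction on the number of generators: when the form [phi] obtained for the others is
   positive on [v], project along [v] onto the kernel of [phi]. *)
Lemma farkas k N (M : 'M[R]_(k, N)) (w : 'rV[R]_N) :
  (exists2 c : 'rV[R]_k, (forall i, 0 <= c 0 i) & w = c *m M) \/
  (exists2 phi : 'cV[R]_N, valid M phi & 0 < (w *m phi) 0 0).
Proof.
elim: k M w => [|k IHk] M w.
  have [w0|/rV0Pn [j wj]] := eqVneq w 0.
    by left; exists 0 => [i|]; rewrite ?mxE // mul0mx.
  right; exists (w 0 j *: delta_mx j 0) => [[]//|].
  by rewrite -scalemxAr -colE !mxE -expr2 exprn_even_gt0.
rewrite -[k.+1]/(1 + k)%N in M *.
rewrite -[M]vsubmxK; move: (usubmx M) (dsubmx M) => v M'.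
have validE f : (v *m f) 0 0 <= 0 -> valid M' f -> valid (col_mx v M') f.
  move=> vf Mf i; rewrite mul_col_mx; rewrite -[i]splitK; case: (split i) => i' /=.
    by rewrite (col_mxEu (v *m f)) ord1.
  by rewrite (col_mxEd (v *m f)).
have [[c c0 ->]|[phi M'phi wphi]] := IHk M' w.
  left; exists (row_mx 0 c) => [i|]; last by rewrite mul_row_col mul0mx add0r.
  rewrite -[i]splitK; case: (split i) => i' /=; last by rewrite row_mxEr.
  by rewrite row_mxEl mxE.
have [vphi|vphi] := leP ((v *m phi) 0 0) 0; first by right; exists phi => //; apply: validE.
set p := (v *m phi) 0 0 in vphi.
have [[c c0 def_w]|[psi M''psi w''psi]] :=
    IHk (M' - p^-1 *: (M' *m phi *m v)) (w - p^-1 *: (w *m phi *m v)).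
  (* The multiples of [v] subtracted by the projection are collected in [a]; it is nonnegative
     because [phi] is positive at [w] and nonpositive on [M']. *)
  left; pose a := p^-1 * ((w *m phi) 0 0 - (c *m (M' *m phi)) 0 0).
  exists (row_mx a%:M c) => [i|].
    rewrite -[i]splitK; case: (split i) => i' /=; last by rewrite row_mxEr.
    rewrite row_mxEl ord1 mxE eqxx mulr1n /a mulr_ge0 ?invr_ge0 ?ltW // subr_gt0.
    apply: le_lt_trans wphi; rewrite mxE; apply: sumr_le0 => j _.
    by rewrite mulr_ge0_le0.
  rewrite mul_row_col mul_scalar_mx.
  move/eqP: def_w; rewrite subr_eq => /eqP ->.
  rewrite mulmxBr -scalemxAr !mulmxA /a mulrBr scalerBl -!scalerA.
  rewrite -!mul_scalar_mx -!mx11_scalar !mul_scalar_mx -!mulmxA.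
  by rewrite addrC addrA addrAC.
(* This is [psi] composed with the projection, so it vanishes at [v]. *)
right; exists (psi - p^-1 *: (phi *m (v *m psi))).
  apply: validE.
    rewrite mulmxBr -scalemxAr (mulmxA v phi) [v *m phi]mx11_scalar -/p mul_scalar_mx scalerA.
    by rewrite mulVf ?gt_eqF // scale1r subrr mxE.
  move=> i; have := M''psi i.
  by rewrite mulmxBl mulmxBr -!scalemxAl -scalemxAr !mulmxA.
by move: w''psi; rewrite mulmxBl mulmxBr -!scalemxAl -scalemxAr !mulmxA.
Qed.

(* Rotate [phi] about its zero set by a form that also vanishes at [x], until a new row is
   hit; vanishing at [x] keeps [phi] negative there. *)
Lemma facet_form_exists k N (M : 'M[R]_(k, N)) (phi : 'cV[R]_N) (x : 'rV[R]_N) :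
  valid M phi -> (x <= M)%MS -> (x *m phi) 0 0 < 0 ->
  exists psi, [/\ facet_form M psi, zeros M phi \subset zeros M psi &
                  (x *m psi) 0 0 < 0].
Proof.
move=> Mphi sxM xphi; have [n] := ubnP (\rank M - \rank (rows_on (zeros M phi) M))%N.
elim: n phi Mphi xphi => // n IHn phi Mphi xphi; rewrite ltnS => le_n.
set Z := zeros M phi in le_n *.
have ltZ : (\rank (rows_on Z M) < \rank M)%N.
  apply: rank_ltmx; rewrite ltmxE rows_on_sub /=; apply/negP => sM.
  have := submx_form_eq0 (submx_trans sxM sM) (mul_rows_on_zeros M phi).
  by move=> e; rewrite e mxE ltxx in xphi.
have [eqr|ner] := eqVneq (\rank (rows_on Z M)).+1 (\rank M); first by exists phi.
(* The zero set has codimension at least two here, so adding [x] does not yet span [M]. *)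
have nsM : ~~ (M <= rows_on Z M + x)%MS.
  apply/negP => /mxrankS; have [+ _] := mxrank_adds_leqif (rows_on Z M) x.
  have := rank_leq_row x; move: ltZ ner; lia.
have [psi0 [Zpsi0 xpsi0 [i0 Mpsi0]]] : exists psi : 'cV[R]_N,
    [/\ rows_on Z M *m psi = 0, x *m psi = 0 & exists i, 0 < (M *m psi) i 0].
  set C := cokermx (rows_on Z M + x)%MS.
  have C0 : (rows_on Z M + x)%MS *m C = 0 by apply: mulmx_coker.
  have MC : M *m C != 0 by rewrite -submxE.
  have [i [j ij]] := matrix0Pn _ MC.
  have E q (A : 'M_(q, N)) : (A <= rows_on Z M + x)%MS -> A *m C = 0.
    by case/submxP => D ->; rewrite -mulmxA C0 mulmx0.
  (* Scaling the cokernel column by its own value at row [i] turns that value into a nonzero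
     square. *)
  exists ((M *m C) i j *: col j C).
  have colC q (A : 'M_(q, N)) : A *m col j C = col j (A *m C) by rewrite !colE mulmxA.
  split; last first.
  - by exists i; rewrite -scalemxAr colC mxE [X in _ * X]mxE -expr2 exprn_even_gt0.
  - by rewrite -scalemxAr colC (E _ x) ?addsmxSr // col0 scaler0.
  - by rewrite -scalemxAr colC E ?addsmxSl // col0 scaler0.
(* Ratio test: the least [t] at which some row reaches zero keeps all the others nonpositive. *)
set P := [pred i | 0 < (M *m psi0) i 0].
have [/= i1 Pi1 min_i1] := arg_minP (fun i => - (M *m phi) i 0 / (M *m psi0) i 0) (Mpsi0 : P i0).
set t := - (M *m phi) i1 0 / (M *m psi0) i1 0 in min_i1.
have t0 : 0 <= t by apply: divr_ge0; [rewrite oppr_ge0; apply: Mphi | apply: ltW].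
have formE i : (M *m (phi + t *: psi0)) i 0 = (M *m phi) i 0 + t * (M *m psi0) i 0.
  by rewrite mulmxDr -scalemxAr !mxE.
have Zpsi0i i : i \in Z -> (M *m psi0) i 0 = 0.
  by move/zerosP/subsetP: Zpsi0 => sZ /sZ; rewrite inE => /eqP.
have sZ : Z \subset zeros M (phi + t *: psi0).
  apply/subsetP => i Zi; rewrite inE formE Zpsi0i // mulr0 addr0.
  by move: Zi; rewrite inE.
have Zi1 : i1 \in zeros M (phi + t *: psi0).
  by rewrite inE formE /t divfK ?subrr ?addrN // gt_eqF.
have [|||chi [fchi sZchi xchi]] := IHn (phi + t *: psi0).
- move=> i; rewrite formE; have [Pi|nPi] := ltP 0 ((M *m psi0) i 0).
    have := min_i1 i Pi; rewrite ler_pdivlMr // => le_i; lra.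
  by rewrite (le_trans (_ : _ <= (M *m phi) i 0)) // gerDl mulr_ge0_le0.
- by rewrite mulmxDr -scalemxAr xpsi0 scaler0 addr0.
- have := rows_on_sub (zeros M (phi + t *: psi0)) M => /mxrankS.
  (* Row [i1] lies outside the span of the old zero rows, since [psi0] vanishes on that span, so the
     rank grows. *)
  suff : (\rank (rows_on Z M) < \rank (rows_on (zeros M (phi + t *: psi0)) M))%N.
    by move: le_n ltZ; lia.
  apply: rank_ltmx; rewrite ltmxE rows_onS //=; apply/negP.
  move/rows_on_subP/(_ i1 Zi1)/submx_form_eq0/(_ Zpsi0)/eqP; rewrite row_form_eq0.
  by rewrite inE gt_eqF.
by exists chi; split=> //; apply: subset_trans sZchi.
Qed.

(** * Homogenization of convex hulls *)

Definition homog p k (M : 'M[R]_(p, k)) : 'M[R]_(k, p + 1) := row_mx M^T (const_mx 1).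

Lemma homog_col p k (M : 'M[R]_(p, k)) j : homog (col j M) = row j (homog M).
Proof. by apply/rowP=> i; rewrite !mxE; case: (split i) => i'; rewrite !mxE. Qed.

Lemma mul_homog p k q (M : 'M[R]_(p, k)) (h : 'M[R]_(k, q)) :
  (forall j, \sum_i h i j = 1) -> h^T *m homog M = homog (M *m h).
Proof.
move=> h1; rewrite /homog mul_mx_row trmx_mul; congr row_mx.
apply/matrixP => j i; rewrite !mxE -[RHS](h1 j); apply: eq_bigr => a _.
by rewrite !mxE mulr1.
Qed.

Lemma in_simplex_delta k (j : 'I_k) : in_simplex (delta_mx j 0 : 'cV[R]_k).
Proof.
split=> [i|]; first by rewrite mxE ler0n.
rewrite (bigD1 j) //= mxE !eqxx big1 ?addr0 // => i ij.
by rewrite mxE (negPf ij).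
Qed.

Lemma conv_sub_col p k (M : 'M[R]_(p, k)) (J : {set 'I_k}) j :
  j \in J -> conv_sub M J (col j M).
Proof.
move=> Jj; exists (delta_mx j 0); split; first exact: in_simplex_delta.
split; last by rewrite colE.
by move=> i nJi; rewrite mxE andbT; case: eqVneq nJi => // ->; rewrite Jj.
Qed.

Lemma conv_sub_conv p k (M : 'M[R]_(p, k)) (J : {set 'I_k}) x :
  conv_sub M J x -> conv M x.
Proof. by case=> h [sh [_ ->]]; exists h. Qed.

Lemma conv_setT p k (M : 'M[R]_(p, k)) x : conv M x <-> conv_sub M [set: 'I_k] x.
Proof.
split; last exact: conv_sub_conv.
by case=> h [sh ->]; exists h; split=> //; split=> // i; rewrite inE.
Qed.

Lemma conv_sub_homog p k (M : 'M[R]_(p, k)) (J : {set 'I_k}) x :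
  conv_sub M J x -> (homog x <= rows_on J (homog M))%MS.
Proof.
case=> h [[_ h1] [hJ ->]].
rewrite -mul_homog => [|j]; last by rewrite ord1.
suff -> : h^T *m homog M = h^T *m rows_on J (homog M) by apply: submxMl.
apply/rowP => j; rewrite !mxE; apply: eq_bigr => i _; rewrite [rows_on _ _ _ _]mxE.
by case: ifPn => // /hJ; rewrite mxE => ->; rewrite !mul0r.
Qed.

(** A linear relation among the rows (x, 1) has coefficients of sum zero; eliminating the one at
    [ord0] leaves a relation among the differences with the point at [ord0]. *)
Lemma aff_indepE p k (P : 'M[R]_(p, k.+1)) : aff_indep P = row_free (homog P).
Proof.
rewrite /aff_indep -mxrank_tr -/(row_free _).
have relP (c : 'rV[R]_k.+1) : c *m homog P = 0 <->
    c 0 ord0 = - \sum_j c 0 (lift ord0 j) /\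
    (\row_j c 0 (lift ord0 j)) *m
      (\matrix_(i < p, j < k) (P i (lift ord0 j) - P i ord0))^T = 0.
  rewrite /homog mul_mx_row.
  have E1 : (c *m (const_mx 1 : 'cV_k.+1) == 0) = (c 0 ord0 == - \sum_j c 0 (lift ord0 j)).
    have -> : c *m (const_mx 1 : 'cV_k.+1) = (\sum_j c 0 j)%:M.
      apply/matrixP => a b; rewrite !ord1 !mxE; apply: eq_bigr => i _.
      by rewrite mxE mulr1.
    rewrite big_ord_recl -[_ == - _]subr_eq0 opprK.
    apply/eqP/eqP => [/matrixP/(_ 0 0)|->]; last by rewrite raddf0.
    by rewrite !mxE eqxx mulr1n.
  have E2 : c 0 ord0 = - \sum_j c 0 (lift ord0 j) ->
      c *m P^T = (\row_j c 0 (lift ord0 j)) *m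
        (\matrix_(i < p, j < k) (P i (lift ord0 j) - P i ord0))^T.
    move=> c0; apply/rowP => i; rewrite !mxE big_ord_recl c0 mulNr mulr_suml addrC.
    rewrite -sumrB; apply: eq_bigr => j _; rewrite !mxE; lra.
  split=> [e|[/[dup] c0 /eqP]].
    have [e1 e2] : c *m P^T = 0 /\ c *m (const_mx 1 : 'cV_k.+1) = 0.
      by apply: eq_row_mx; rewrite e row_mx0.
    by move/eqP: e2; rewrite E1 => /eqP c0; rewrite -E2.
  by rewrite -E1 -E2 // => /eqP -> ->; rewrite row_mx0.
apply/idP/idP => free; apply: inj_row_free => c.
  move/relP => [c0 cD].
  have : \row_j c 0 (lift ord0 j) = 0 by apply: (row_free_inj free); rewrite /= cD mul0mx.
  move/rowP => cl; have cl0 j : c 0 (lift ord0 j) = 0 by have := cl j; rewrite !mxE.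
  apply/rowP => i; rewrite mxE; case: (unliftP ord0 i) => [j ->|->]; first exact: cl0.
  by rewrite c0 big1 ?oppr0.
move=> cD.
pose e : 'rV_k.+1 := \row_i oapp (c 0) (- \sum_j c 0 j) (unlift ord0 i).
have el j : e 0 (lift ord0 j) = c 0 j by rewrite mxE liftK.
have : e = 0.
  apply: (row_free_inj free); rewrite /= mul0mx; apply/relP; split.
    by rewrite mxE unlift_none /=; congr (- _); apply: eq_bigr => j _; rewrite el.
  by rewrite (_ : \row_j _ = c) //; apply/rowP => j; rewrite mxE el.
by move/rowP => e0; apply/rowP => j; rewrite -el e0 !mxE.
Qed.

(** Homogenized points of the hull lie in the row span, which bounds an independent family;
    conversely a maximal free family of rows consists of nonzero rows, hence of columns of [M]
    indexed by [J]. *)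
Lemma indep_pointsP p k (M : 'M[R]_(p, k)) (J : {set 'I_k}) S q :
  (forall x, S x <-> conv_sub M J x) ->
  (exists P : 'M[R]_(p, q.+1), (forall j, S (col j P)) /\ aff_indep P) <->
  (q < \rank (rows_on J (homog M)))%N.
Proof.
move=> SE; split=> [[P [SP]]|].
  rewrite aff_indepE => /eqP <-; apply/mxrankS/row_subP => j.
  by rewrite -homog_col; apply: conv_sub_homog; apply/SE.
set A := rows_on J (homog M) => ltq.
pose f (j : 'I_q.+1) : 'I_k := maxrankfun A (widen_ord ltq j).
have rowA j : row (f j) A != 0.
  apply/eqP => Af0.
  have : delta_mx 0 (widen_ord ltq j) = 0 :> 'rV[R]_(\rank A).
    by apply: (row_free_inj (maxrowsub_free A)); rewrite /= mul0mx -rowE row_rowsub.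
  by move/rowP/(_ (widen_ord ltq j)); rewrite !mxE !eqxx => /eqP; rewrite oner_eq0.
have Jf j : f j \in J.
  by apply: contraNT (rowA j) => nJ; rewrite row_rows_on (negPf nJ).
exists (colsub f M); split=> [j|].
  have -> : col j (colsub f M) = col (f j) M by apply/colP => i; rewrite !mxE.
  by apply/SE/conv_sub_col.
rewrite aff_indepE.
have -> : homog (colsub f M) = rowsub (widen_ord ltq) (rowsub (maxrankfun A) A).
  apply/matrixP => i j; rewrite [RHS]mxE [RHS]mxE [RHS]mxE Jf !mxE.
  by case: (split j) => j'; rewrite !mxE.
apply: inj_row_free => c; rewrite rowsubE mulmxA => c0.
have : c *m rowsub (widen_ord ltq) 1%:M = 0 by apply: (row_free_inj (maxrowsub_free A)); rewrite /= mul0mx.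
move/rowP => cw; apply/rowP => j; have := cw (widen_ord ltq j).
rewrite !mxE (bigD1 j) //= !mxE eqxx mulr1 big1 ?addr0 // => i ij.
by rewrite !mxE -(inj_eq val_inj) /= (inj_eq val_inj) (negPf ij) mulr0.
Qed.

(** The shift by one also covers dimension -1: a homogenized point is never zero, so rank 0 means
    the empty set. *)
Lemma has_dimP p k (M : 'M[R]_(p, k)) (J : {set 'I_k}) S z :
  (forall x, S x <-> conv_sub M J x) ->
  has_dim S z <-> z + 1 = (\rank (rows_on J (homog M)))%:Z.
Proof.
move=> SE; pose J' := rows_on J (homog M).
have empty : (forall x, ~ S x) <-> \rank J' = 0%N.
  split=> [S0|rJ x Sx].
    have J0 : J = set0.
      by apply/setP => j; rewrite inE; apply/negP => /(conv_sub_col M)/SE/S0.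
    apply/eqP; rewrite mxrank_eq0; apply/eqP/matrixP => i j.
    by rewrite !mxE J0 inE.
  have /mxrankS : (homog x <= J')%MS by apply/conv_sub_homog/SE.
  rewrite rJ leqn0 mxrank_eq0 => /eqP/matrixP/(_ 0 (rshift _ 0)).
  by rewrite /homog row_mxEr !mxE => /eqP; rewrite oner_eq0.
have affdimE q : affdim_nat S q <-> \rank J' = q.+1.
  rewrite /affdim_nat; split=> [[/(indep_pointsP _ SE) lt_q le_q]|rJ].
    apply/eqP; rewrite eqn_leq lt_q andbT leqNgt; apply/negP.
    by case/(indep_pointsP _ SE) => P [SP]; apply/negP/le_q.
  split; first by apply/(indep_pointsP _ SE); rewrite -/J' rJ.
  move=> P SP; apply/negP => indP.
  have : (q.+1 < \rank J')%N by apply/(indep_pointsP _ SE); exists P.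
  by rewrite rJ ltnn.
split=> [[[-> /empty rJ]|[q [-> /affdimE rJ]]]|ez].
- by rewrite -/J' rJ.
- by rewrite -/J' rJ; lia.
case: (posnP (\rank J')) => [r0|].
  by left; split; [rewrite -/J' r0 in ez; lia | apply/empty].
move=> r0; right; exists (\rank J').-1; split; first by rewrite -/J' in ez; lia.
by apply/affdimE; rewrite prednK.
Qed.

Lemma homog_form p k (M : 'M[R]_(p, k)) (h : 'cV[R]_k) (phi : 'cV[R]_(p + 1)) :
  in_simplex h -> (homog (M *m h) *m phi) 0 0 = \sum_i h i 0 * (homog M *m phi) i 0.
Proof.
case=> _ h1; rewrite -mul_homog => [|j]; last by rewrite ord1.
by rewrite -mulmxA mxE; apply: eq_bigr => i _; rewrite mxE.
Qed.

Lemma homog_col_mx p (x : 'cV[R]_p) a (b : 'M[R]_1) :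
  (homog x *m col_mx a b) 0 0 = (a^T *m x) 0 0 + b 0 0.
Proof.
rewrite mul_row_col mxE; congr (_ + _); last by rewrite mxE big_ord1 mxE mul1r.
by rewrite -[a in LHS]trmxK -trmx_mul mxE.
Qed.

Lemma valid_homog p k (M : 'M[R]_(p, k)) (phi : 'cV[R]_(p + 1)) :
  valid (homog M) phi <-> forall x, conv M x -> (homog x *m phi) 0 0 <= 0.
Proof.
split=> [Mphi x [h [sh ->]]|le0 i].
  rewrite homog_form //; apply: sumr_le0 => i _; apply: mulr_ge0_le0 => //.
  by case: sh.
rewrite -row_form -homog_col; apply/le0/conv_setT/conv_sub_col.
by rewrite inE.
Qed.

(** A convex combination of nonpositive values is zero only if every column of nonzero weight has
    value zero. *)
Lemma conv_sub_zeros p k (M : 'M[R]_(p, k)) (phi : 'cV[R]_(p + 1)) x :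
  valid (homog M) phi ->
  conv_sub M (zeros (homog M) phi) x <-> conv M x /\ (homog x *m phi) 0 0 = 0.
Proof.
move=> Mphi; split=> [/[dup] Zx [h [sh [hZ ->]]]|[[h [sh ->]]]].
  split; first by exists h.
  rewrite homog_form // big1 // => i _.
  have [|/hZ->] := boolP (i \in zeros (homog M) phi); last by rewrite mul0r.
  by rewrite inE => /eqP ->; rewrite mulr0.
rewrite homog_form // => sum0; exists h; split=> //; split=> // i nZi.
have le0 j : h j 0 * (homog M *m phi) j 0 <= 0 by apply: mulr_ge0_le0 => //; case: sh.
have /eqP : - \sum_i h i 0 * (homog M *m phi) i 0 = 0 by rewrite sum0 oppr0.
rewrite -sumrN psumr_eq0 => [|j _]; last by rewrite oppr_ge0.
move/allP/(_ i (mem_index_enum _)); rewrite /= oppr_eq0 mulf_eq0.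
by move: nZi; rewrite inE => /negPf ->; rewrite orbF => /eqP.
Qed.

Lemma is_faceP p k (M : 'M[R]_(p, k)) F :
  is_face (conv M) F <-> exists2 phi, valid (homog M) phi &
    forall x, F x <-> conv_sub M (zeros (homog M) phi) x.
Proof.
split=> [[a [b [le_b FE]]]|[phi Mphi FE]].
  (* The inequality [a *m x <= b] becomes the form (a, -b) evaluated at (x, 1). *)
  have formE (x : 'cV[R]_p) : (homog x *m col_mx a^T (- b)%:M) 0 0 = (a *m x) 0 0 - b.
    by rewrite homog_col_mx trmxK [(- b)%:M 0 0]mxE eqxx mulr1n.
  have Mphi : valid (homog M) (col_mx a^T (- b)%:M).
    by apply/valid_homog => x /le_b; rewrite formE subr_le0.
  exists (col_mx a^T (- b)%:M) => // x.
  rewrite FE conv_sub_zeros // formE.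
  by split=> -[Mx /eqP e]; split=> //; apply/eqP; rewrite ?subr_eq0 // -subr_eq0.
exists (usubmx phi)^T, (- dsubmx phi 0 0).
have formE (x : 'cV[R]_p) : (homog x *m phi) 0 0 = ((usubmx phi)^T *m x) 0 0 + dsubmx phi 0 0.
  by rewrite -[phi in LHS]vsubmxK homog_col_mx.
split=> x.
  by move=> Mx; rewrite -subr_le0 opprK -formE; move/valid_homog: Mphi; apply.
rewrite FE conv_sub_zeros // formE.
by split=> -[Mx /eqP e]; split=> //; apply/eqP; rewrite ?addr_eq0 // -addr_eq0.
Qed.

Lemma is_facetP p k (M : 'M[R]_(p, k)) F :
  is_facet (conv M) F <-> exists2 phi, facet_form (homog M) phi &
    forall x, F x <-> conv_sub M (zeros (homog M) phi) x.
Proof.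
have rT : rows_on [set: 'I_k] (homog M) = homog M.
  by apply/matrixP => i j; rewrite mxE inE.
split=> [[/is_faceP [phi Mphi FE] [z [/(has_dimP _ (conv_setT M)) + /(has_dimP _ FE)]]]|].
  by rewrite rT => ez ez'; exists phi => //; split=> //; move: ez ez'; lia.
case=> phi [Mphi rZ] FE; split; first by apply/is_faceP; exists phi.
exists ((\rank (homog M))%:Z - 1).
split; first by apply/(has_dimP _ (conv_setT M)); rewrite rT; lia.
by apply/(has_dimP _ FE); move: rZ; lia.
Qed.

(** * Facets under the facet-based conditions *)

Lemma facet_form_neg k N (M : 'M[R]_(k, N)) (phi : 'cV[R]_N) :
  facet_form M phi -> exists i, (M *m phi) i 0 < 0.
Proof.
case=> Mphi rZ; apply/existsP; apply: contraT; rewrite negb_exists => /forallP ge0.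
suff sM : (M <= rows_on (zeros M phi) M)%MS by move/mxrankS: sM; rewrite -rZ ltnn.
apply/row_subP => i; apply: row_sub_rows_on; rewrite inE eq_le Mphi.
by have := ge0 i; rewrite -leNgt.
Qed.

Lemma valid_mulmx_homog p n r (W : 'M[R]_(p, r)) (H : 'M[R]_(r, n)) (phi : 'cV[R]_(p + 1)) :
  (forall j, in_simplex (col j H)) -> valid (homog W) phi -> valid (homog (W *m H)) phi.
Proof.
move=> sH /valid_homog Wphi j; rewrite -row_form -homog_col; apply: Wphi.
by exists (col j H); split; [apply: sH | rewrite !colE mulmxA].
Qed.

Lemma homog_mulmx_sub p n r (W : 'M[R]_(p, r)) (H : 'M[R]_(r, n)) :
  (forall j, in_simplex (col j H)) -> (homog (W *m H) <= homog W)%MS.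
Proof.
move=> sH; rewrite -mul_homog ?submxMl // => j; have [_ <-] := sH j.
by apply: eq_bigr => i _; rewrite mxE.
Qed.

Lemma FBC_facet_cols p n r (X : 'M[R]_(p, n)) (W : 'M[R]_(p, r)) H s phi :
  FBC X W H s -> facet_form (homog W) phi ->
  exists J : {set 'I_n}, [/\ J \subset zeros (homog X) phi,
    {in J &, forall j j', col j X = col j' X -> j = j'}, (s <= #|J|)%N, J != set0 &
    (\rank X <= (\rank (rows_on J (homog X))).+1)%N].
Proof.
case=> _ [_ [[le_ds cF] _]] Wphi.
have [J [[FJ injJ] [le_s dimJ]]] :
    exists J : {set 'I_n}, distinct_cols_in X (conv_sub W (zeros (homog W) phi)) J /\
      (s <= #|J|)%N /\ has_dim (conv_sub X J) ((\rank X)%:Z - 2).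
  by apply: cF; apply/is_facetP; exists phi.
move/(has_dimP _ (fun x => iff_refl _)): dimJ => rJ.
exists J; split=> //.
- apply/subsetP => j /FJ /conv_sub_zeros [|_]; first by case: Wphi.
  by rewrite homog_col row_form inE => ->.
(* A dimension d - 2 is at least -1, so s >= d >= 1. *)
- by apply/eqP => J0; move: le_s le_ds rJ; rewrite J0 cards0; lia.
- by move: rJ; lia.
Qed.

(** By the contrapositive of (d), the facet [psi = 0] of conv(X) is also cut out of conv(W) by some
    facet form [phi]. On conv(W), [phi] is then a positive multiple of [psi]. *)
Lemma FBC_facet_form p n r (X : 'M[R]_(p, n)) (W : 'M[R]_(p, r)) H s psi (J : {set 'I_n}) :
  X = W *m H -> FBC X W H s -> facet_form (homog X) psi ->
  J \subset zeros (homog X) psi -> {in J &, forall j j', col j X = col j' X -> j = j'} ->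
  (s <= #|J|)%N ->
  [/\ \rank (homog X) = \rank (homog W), valid (homog W) psi &
      forall k, k \in zeros (homog W) psi -> conv X (col k W)].
Proof.
move=> defX [_ [sH [_ dF]]] Xpsi sJ injJ le_s.
set F := conv_sub X (zeros (homog X) psi).
have FX j : j \in zeros (homog X) psi -> F (col j X) by apply: conv_sub_col.
have /is_facetP [phi Wphi FE] : is_facet (conv W) F.
  apply: NNPP => nF; have := dF F _ nF J; rewrite ltnNge le_s => /(_ _ _)/notF; apply.
    by apply/is_facetP; exists psi.
  by split=> // j /(subsetP sJ)/FX.
(* Both ranks are the dimension of the same set [F] plus one. *)
have rZ : \rank (rows_on (zeros (homog X) psi) (homog X)) = \rank (rows_on (zeros (homog W) phi) (homog W)).
  have /(has_dimP _ FE) : has_dim F ((\rank (rows_on (zeros (homog X) psi) (homog X)))%:Z - 1).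
    by apply/(has_dimP (M := X)) => [x|]; [apply: iff_refl | lia].
  lia.
have rXW : \rank (homog X) = \rank (homog W) by rewrite -(proj2 Xpsi) -(proj2 Wphi) rZ.
have sXW : (homog X <= homog W)%MS by rewrite defX homog_mulmx_sub.
have [i Xpsii] := facet_form_neg Xpsi.
have phiX : rows_on (zeros (homog X) psi) (homog X) *m phi = 0.
  apply/zerosP/subsetP => j /FX/FE/conv_sub_zeros [|_]; first by case: Wphi.
  by rewrite homog_col row_form inE => ->.
have := forms_proportional (submx_trans (rows_on_sub _ _) sXW) _
  (submx_trans (row_sub i _) sXW) (mul_rows_on_zeros _ _) phiX.
rewrite !row_form (proj2 Xpsi) rXW leqnn lt_eqF // => /(_ isT isT).
set l := _ / _ => def_phi.
have Xphi : valid (homog X) phi by rewrite defX; apply: valid_mulmx_homog => //; case: Wphi.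
(* Both forms are nonpositive at column [i] of [X], and [l = 0] would make [phi] vanish on all of
   [W]. *)
have l_gt0 : 0 < l.
  have l_ge0 : 0 <= l by apply: mulr_le0; rewrite ?invr_le0 ?(ltW Xpsii).
  rewrite lt_def l_ge0 andbT.
  apply/eqP => l0; have [k] := facet_form_neg Wphi.
  by rewrite def_phi l0 scale0r mxE ltxx.
have psiE k : (homog W *m phi) k 0 = l * (homog W *m psi) k 0 by rewrite def_phi mxE.
split=> // k; first by have := proj1 Wphi k; rewrite psiE pmulr_rle0.
rewrite inE => psik; apply/conv_sub_conv/FE/conv_sub_col.
by rewrite inE psiE mulf_eq0 psik orbT.
Qed.

(** The row of ones adds at most one to the rank; this limits the trace of a facet on conv(X) to
    codimension two. *)
Lemma rank_homog_le p n (X : 'M[R]_(p, n)) : (\rank (homog X) <= (\rank X).+1)%N.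
Proof.
rewrite -mxrank_tr /homog tr_row_mx trmxK -addsmxE.
have [+ _] := mxrank_adds_leqif X (const_mx 1 : 'M[R]_(n, 1))^T.
by move/leq_trans; apply; rewrite -[leqRHS]addn1 leq_add2l rank_leq_row.
Qed.

Lemma homog_const p k (M : 'M[R]_(p, k)) : homog M *m col_mx 0 1%:M = const_mx 1.
Proof. by rewrite mul_row_col mulmx0 mulmx1 add0r. Qed.

(** Farkas' lemma separates column [k] from the others: the last homogeneous coordinate would make
    the weights of a nonnegative combination sum to 1, contradicting extremality. Subtracting the
    constant [t], the value at [k], makes the form zero there. *)
Lemma vertex_form p r (W : 'M[R]_(p, r)) k :
  ~ (exists h : 'cV[R]_r, in_simplex h /\ h k 0 = 0 /\ col k W = W *m h) ->
  exists phi, [/\ valid (homog W) phi, k \in zeros (homog W) phi &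
    forall j, j != k -> (homog W *m phi) j 0 < 0].
Proof.
move=> extk.
have [[c c0 def_k]|[phi phi0 phik]] := farkas (rows_on [set~ k] (homog W)) (row k (homog W)).
  pose h : 'cV[R]_r := \col_j (if j == k then 0 else c 0 j).
  have def_h : row k (homog W) = h^T *m homog W.
    rewrite def_k; apply/rowP => i; rewrite !mxE; apply: eq_bigr => j _.
    by rewrite !mxE !inE; case: eqP; rewrite ?mul0r ?mulr0.
  have : homog (col k W) = row_mx (W *m h)^T (\sum_j h j 0)%:M.
    rewrite homog_col def_h mul_mx_row -trmx_mul; congr row_mx.
    apply/matrixP => a b; rewrite !ord1 !mxE eqxx mulr1n.
    by apply: eq_bigr => j _; rewrite !mxE mulr1.
  case/eq_row_mx => /trmx_inj kW /matrixP/(_ 0 0); rewrite !mxE eqxx mulr1n => h1.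
  case: extk; exists h; split; last by rewrite kW mxE eqxx.
  by split=> // j; rewrite mxE; case: ifP.
set t := (row k (homog W) *m phi) 0 0 in phik.
have formE j : (homog W *m (phi - t *: col_mx 0 1%:M)) j 0 = (homog W *m phi) j 0 - t.
  by rewrite mulmxBr -scalemxAr homog_const !mxE mulr1.
have neg j : j != k -> (homog W *m (phi - t *: col_mx 0 1%:M)) j 0 < 0.
  move=> jk; rewrite formE subr_lt0; apply: le_lt_trans phik.
  by have := phi0 j; rewrite -row_form row_rows_on !inE jk row_form.
have zk : (homog W *m (phi - t *: col_mx 0 1%:M)) k 0 = 0.
  by rewrite formE /t row_form subrr.
exists (phi - t *: col_mx 0 1%:M); split=> //; last by rewrite inE zk.
by move=> j; have [->|/neg/ltW //] := eqVneq j k; rewrite zk.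
Qed.

Lemma FBC_cols_in_conv p n r (X : 'M[R]_(p, n)) (W : 'M[R]_(p, r)) H s :
  X = W *m H -> FBC X W H s -> forall k, conv X (col k W).
Proof.
move=> defX fbc k; have [extW [sH _]] := fbc.
have sXW : (homog X <= homog W)%MS by rewrite defX homog_mulmx_sub.
(* The constant form -1 is valid and nowhere zero, so it rotates to a facet missing a prescribed
   column. *)
pose u : 'cV[R]_(p + 1) := - col_mx 0 1%:M.
have formu q (M : 'M[R]_(p, q)) i : (homog M *m u) i 0 = -1.
  by rewrite mulmxN homog_const !mxE.
have validu q (M : 'M[R]_(p, q)) : valid (homog M) u by move=> i; rewrite formu lerN10.
have validX phi : valid (homog W) phi -> valid (homog X) phi.
  by move=> Wphi; rewrite defX; apply: valid_mulmx_homog.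
have facetX phi j : facet_form (homog W) phi -> (homog X *m phi) j 0 < 0 ->
    exists psi, [/\ facet_form (homog X) psi, zeros (homog X) phi \subset zeros (homog X) psi &
                    (homog X *m psi) j 0 < 0].
  move=> [Wphi _]; rewrite -row_form => /(facet_form_exists (validX _ Wphi) (row_sub j _)).
  by case=> psi [? ?]; rewrite row_form; exists psi.
have [phi0 [Wphi0 _]] : exists psi, [/\ facet_form (homog W) psi,
    zeros (homog W) u \subset zeros (homog W) psi & (row k (homog W) *m psi) 0 0 < 0].
  by apply: facet_form_exists; rewrite ?row_sub // row_form formu ltrN10.
rewrite row_form => phi0k.
have [J0 [sJ0 _ _ /set0Pn [j0 /(subsetP sJ0) Zj0] _]] := FBC_facet_cols fbc Wphi0.
(* If [W] had a single column, all columns of [X] would equal it, yet [phi0] is zero at [j0] and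
   negative at [k]. *)
have [k' k'k] : exists k', k' != k.
  apply/existsP; apply: contraT; rewrite negb_exists => /forallP allk.
  move: Zj0; rewrite inE; suff -> : (homog X *m phi0) j0 0 = (homog W *m phi0) k 0.
    by rewrite lt_eqF.
  have k1 i : i = k by apply/eqP/negbNE/allk.
  rewrite -[LHS]row_form -[RHS]row_form -!homog_col; congr ((homog _ *m _) 0 0).
  rewrite defX [col j0 _]colE -mulmxA -colE.
  have [_] := sH j0; rewrite (bigD1 k) //= big1 ?addr0 => [hk|i]; last by rewrite (k1 i) eqxx.
  apply/colP => a; rewrite mxE (bigD1 k) //= big1 ?addr0 => [|i]; last by rewrite (k1 i) eqxx.
  by rewrite hk mulr1 mxE.
(* A facet of conv(W) missing column [j0] of [X] rotates to a facet of conv(X) to which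
   [FBC_facet_form] applies. *)
have rXW : \rank (homog X) = \rank (homog W).
  have [phi1 [Wphi1 _]] : exists psi, [/\ facet_form (homog W) psi,
      zeros (homog W) u \subset zeros (homog W) psi & (row j0 (homog X) *m psi) 0 0 < 0].
    apply: facet_form_exists; rewrite ?(submx_trans (row_sub _ _) sXW) //.
    by rewrite row_form formu ltrN10.
  rewrite row_form => /(facetX _ _ Wphi1) [psi [Xpsi sZ _]].
  have [J [sJ injJ le_s _ _]] := FBC_facet_cols fbc Wphi1.
  by have [] := FBC_facet_form defX fbc Xpsi (subset_trans sJ sZ) injJ le_s.
(* The form exposing column [k] is negative at [k'], so it rotates to a facet through column [k]. *)
have [phi [Wphi Zk _]] : exists psi, [/\ facet_form (homog W) psi, k \in zeros (homog W) psi &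
    (row k' (homog W) *m psi) 0 0 < 0].
  have [chi [Wchi Zk neg]] := vertex_form (extW k).
  have [|psi [? /subsetP/(_ k Zk) ? ?]] := facet_form_exists (x := row k' (homog W)) Wchi (row_sub _ _).
    by rewrite row_form neg.
  by exists psi.
have [J [sJ injJ le_s _ rJ]] := FBC_facet_cols fbc Wphi.
have Xphi := validX _ (proj1 Wphi).
set K := zeros (homog X) phi in sJ *.
have [rK|neK] := eqVneq (\rank (rows_on K (homog X))).+1 (\rank (homog X)).
  by have [_ _ ] := FBC_facet_form defX fbc (conj Xphi rK) sJ injJ le_s; apply.
exfalso.
have [j1 phij1] : exists j, (homog X *m phi) j 0 < 0.
  apply/existsP; apply: contraT; rewrite negb_exists => /forallP ge0.
  have X0 : homog X *m phi = 0.
    apply/colP => j; rewrite [RHS]mxE; apply/eqP; rewrite eq_le Xphi.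
    by have := ge0 j; rewrite -leNgt.
  have sWX : (homog W <= homog X)%MS by rewrite -(mxrank_leqif_sup sXW) rXW.
  have [i] := facet_form_neg Wphi.
  by rewrite (submx_form_eq0 sWX X0) mxE ltxx.
have ltK : (\rank (rows_on K (homog X)) < \rank (homog X))%N.
  by apply: (rank_rows_on_zeros (i := j1)); rewrite lt_eqF.
(* The columns [J] give [K] rank at least d - 1, while [homog X] has rank at most d + 1. *)
have rK : \rank (homog X) = (\rank (rows_on K (homog X))).+2.
  have := rank_homog_le X; have := mxrankS (rows_onS (homog X) sJ).
  by move: rJ neK ltK; lia.
(* Rotate [phi] about [K] twice, the second time keeping a point of the first facet
   off the zero set so as to obtain a different facet. *)
have [psi [Xpsi sKpsi _]] := facetX _ _ Wphi phij1.
have [_ Wpsi _] := FBC_facet_form defX fbc Xpsi (subset_trans sJ sKpsi) injJ le_s.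
have [j2 Zj2 phij2] : exists2 j, j \in zeros (homog X) psi & (homog X *m phi) j 0 < 0.
  have /subsetPn [j Zj nKj] : ~~ (zeros (homog X) psi \subset K).
    apply/negP => /(rows_onS (homog X))/mxrankS; have := proj2 Xpsi; rewrite rK.
    by move=> [->]; rewrite ltnn.
  by exists j => //; rewrite lt_def Xphi andbT eq_sym; move: nKj; rewrite inE.
have [f [Xf sKf fj2]] := facetX _ _ Wphi phij2.
have [_ Wf _] := FBC_facet_form defX fbc Xf (subset_trans sJ sKf) injJ le_s.
(* Otherwise [psi] vanishes on the facet of [phi] and is a multiple of [phi]; at [j2], where only
   [psi] is zero, the factor is seen to be 0. *)
have [i0 Zi0 psii0] : exists2 i, i \in zeros (homog W) phi & (homog W *m psi) i 0 < 0.
  apply/exists_inP; apply: contraT => /exists_inPn ge0.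
  have psiK : rows_on (zeros (homog W) phi) (homog W) *m psi = 0.
    apply/zerosP/subsetP => i /ge0; rewrite -leNgt => psii.
    by rewrite inE eq_le Wpsi psii.
  have := forms_proportional (rows_on_sub _ _) _ (submx_trans (row_sub j2 _) sXW)
    (mul_rows_on_zeros _ _) psiK.
  rewrite !row_form (proj2 Wphi) leqnn lt_eqF // => /(_ isT isT).
  move: Zj2; rewrite inE => /eqP ->; rewrite mul0r scale0r => Wpsi0.
  have [j] := facet_form_neg Xpsi.
  by rewrite (submx_form_eq0 sXW Wpsi0) mxE ltxx.
have : exists2 ab : R * R, 0 < ab.1 & homog W *m f = ab.1 *: (homog W *m phi) + ab.2 *: (homog W *m psi).
  (* With this [a], the form [f - a *: phi] vanishes at [j2] and on [K]. These span codimension one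
     and [psi] vanishes there too, so the difference is a multiple of [psi]. *)
  set a := (homog X *m f) j2 0 / (homog X *m phi) j2 0.
  have [j3 psij3] := facet_form_neg Xpsi.
  set S := rows_on (j2 |: K) (homog X).
  have rS : (\rank (homog W) <= (\rank S).+1)%N.
    rewrite -rXW rK ltnS; apply: rank_ltmx; rewrite ltmxE rows_onS ?subsetUr //=.
    apply/negP => /rows_on_subP/(_ j2 (setU11 _ _))/submx_form_eq0.
    move/(_ _ (mul_rows_on_zeros _ _))/eqP; rewrite row_form_eq0 inE.
    by rewrite lt_eqF.
  have Spsi : S *m psi = 0 by apply/zerosP; rewrite subUset sub1set Zj2.
  have gE j : (homog X *m (f - a *: phi)) j 0 =
      (homog X *m f) j 0 - a * (homog X *m phi) j 0.
    by rewrite mulmxBr -scalemxAr !mxE.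
  have Sg : S *m (f - a *: phi) = 0.
    apply/zerosP; rewrite subUset sub1set inE; apply/andP; split.
      by rewrite gE /a divfK ?subrr // lt_eqF.
    apply/subsetP => j Kj; move/subsetP/(_ j Kj): sKf; move: Kj; rewrite !inE.
    by rewrite gE => /eqP e1 /eqP e2; rewrite e1 e2 mulr0 subrr.
  have := forms_proportional (submx_trans (rows_on_sub _ _) sXW) rS
    (submx_trans (row_sub j3 _) sXW) Spsi Sg.
  rewrite !row_form lt_eqF // => /(_ isT); set b := _ / _ => Wg.
  exists (a, b); first by rewrite /= /a -mulrNN -invrN divr_gt0 // oppr_gt0.
  by rewrite /= -Wg mulmxBr -scalemxAr addrC subrK.
case=> -[a b] /= a0 fE.
have fiE i : (homog W *m f) i 0 = a * (homog W *m phi) i 0 + b * (homog W *m psi) i 0.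
  by rewrite fE !mxE.
(* At [i0], [phi] is zero, [psi] is negative and [f] is nonpositive. *)
have b0 : 0 <= b.
  have := Wf i0; rewrite fiE; move: Zi0; rewrite inE => /eqP ->.
  by rewrite mulr0 add0r nmulr_lle0.
(* Where [f] is zero, a phi = - b psi >= 0 forces phi = 0. The zeros of [f] then have at most the
   rank of [K], one less than a facet requires. *)
have : zeros (homog X) f \subset K.
  apply/subsetP => j; rewrite !inE.
  have -> : (homog X *m f) j 0 = a * (homog X *m phi) j 0 + b * (homog X *m psi) j 0.
    case/submxP: sXW => D ->; rewrite -!mulmxA fE mulmxDr -!scalemxAr.
    by rewrite mxE [in LHS]mxE [X in _ + X]mxE.
  move/eqP => e; rewrite eq_le Xphi /=.
  have := Xphi j; have := proj1 Xpsi j.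
  move: e; set x := _ j 0; set y := (homog X *m psi) j 0 => e y0 x0.
  rewrite -(pmulr_rge0 _ a0).
  by have := mulr_ge0_le0 b0 y0; lra.
move/(rows_onS (homog X))/mxrankS; have [_] := Xf; rewrite rK => -[->].
by rewrite ltnn.
Qed.

(** * Convex position *)

Lemma in_simplex_le1 r (c : 'cV[R]_r) k : in_simplex c -> c k 0 <= 1.
Proof. by case=> c0 <-; rewrite (bigD1 k) //= lerDl sumr_ge0. Qed.

Lemma in_simplex_eq1 r (c : 'cV[R]_r) k : in_simplex c -> c k 0 = 1 -> c = delta_mx k 0.
Proof.
case=> c0 c1 ck; apply/colP => i; rewrite mxE andbT.
have [->|ik] := eqVneq i k; first by rewrite ck.
have : \sum_(j | j != k) c j 0 == 0 by move: c1; rewrite (bigD1 k) //= ck; lra.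
by rewrite psumr_eq0 // => /allP/(_ i (mem_index_enum _))/implyP/(_ ik)/eqP.
Qed.

Lemma in_simplex_mulmx r q (G : 'M[R]_(r, q)) (h : 'cV[R]_q) :
  (forall l, in_simplex (col l G)) -> in_simplex h -> in_simplex (G *m h).
Proof.
move=> sG [h0 h1]; split=> [i|].
  rewrite mxE sumr_ge0 // => l _; rewrite mulr_ge0 //.
  by have [/(_ i)] := sG l; rewrite mxE.
rewrite -h1; under eq_bigr do rewrite mxE.
rewrite exchange_big; apply: eq_bigr => l _ /=; rewrite -mulr_suml.
have [_ Gl1] := sG l; rewrite -[RHS]mul1r -Gl1; congr (_ * _).
by apply: eq_bigr => i _; rewrite mxE.
Qed.

(** Otherwise removing the share of column [k] and dividing by [1 - c k 0] writes it as a convex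
    combination of the other columns. *)
Lemma extreme_coef p r (W : 'M[R]_(p, r)) k (c : 'cV[R]_r) :
  ~ (exists h : 'cV[R]_r, in_simplex h /\ h k 0 = 0 /\ col k W = W *m h) ->
  in_simplex c -> col k W = W *m c -> c k 0 = 1.
Proof.
move=> extk sc kW; apply/eqP; apply: contraT => ck.
have [c0 c1] := sc; have ck1 : 0 < 1 - c k 0.
  by rewrite subr_gt0 lt_def eq_sym ck in_simplex_le1.
case: extk; exists ((1 - c k 0)^-1 *: (c - c k 0 *: delta_mx k 0)).
have E i : ((1 - c k 0)^-1 *: (c - c k 0 *: delta_mx k 0)) i 0 =
    (1 - c k 0)^-1 * (if i == k then 0 else c i 0).
  rewrite !mxE andbT; congr (_ * _); case: eqP => [->|_].
    by rewrite mulr1 subrr.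
  by rewrite mulr0 subr0.
split; last split.
- split=> [i|].
    by rewrite E mulr_ge0 ?invr_ge0 ?(ltW ck1) //; case: ifP.
  under eq_bigr do rewrite E.
  rewrite -mulr_sumr (bigD1 k) //= eqxx add0r.
  rewrite (eq_bigr (fun i => c i 0)) => [|i /negPf -> //].
  have -> : \sum_(i | i != k) c i 0 = 1 - c k 0.
    by rewrite -c1 [in RHS](bigD1 k) //= addrC addrK.
  by rewrite mulVf ?gt_eqF.
- by rewrite E eqxx mulr0.
rewrite -scalemxAr mulmxBr -kW -scalemxAr -colE -{2}[col k W]scale1r -scalerBl.
by rewrite scalerA mulVf ?gt_eqF // scale1r.
Qed.

(** Writing [V = W *m G] and column [k] of [W] as [V *m h], extremality makes entry [k] of [G *m h]
    equal to 1. It averages entries of [G] that are at most 1, so some column of [G] is the unit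
    vector at [k]. *)
Lemma convex_position_perm p r (W V : 'M[R]_(p, r)) :
  (forall k, ~ (exists h : 'cV[R]_r, in_simplex h /\ h k 0 = 0 /\ col k W = W *m h)) ->
  (forall k, conv V (col k W)) -> (forall l, conv W (col l V)) ->
  exists s : 'S_r, V = W *m perm_mx s.
Proof.
move=> extW WV /fin_all_exists [g gP].
pose G := \matrix_(i, l) g l i 0.
have colG l : col l G = g l by apply/colP => i; rewrite !mxE.
have defV : V = W *m G.
  apply/trmx_inj/row_matrixP => l; rewrite -!tr_col; congr (_^T).
  by rewrite (proj2 (gP l)) -colG !colE mulmxA.
have sG l : in_simplex (col l G) by rewrite colG; case: (gP l).
have /fin_all_exists [f fP] k : exists l, col l V = col k W.
  have [h [sh kW]] := WV k; have [h0 h1] := sh.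
  have ck1 : (G *m h) k 0 = 1.
    by apply: (extreme_coef (extW k)); [apply: in_simplex_mulmx | rewrite mulmxA -defV].
  have le1 l : G k l <= 1 by have := in_simplex_le1 k (sG l); rewrite mxE.
  have /existsP [l] : [exists l, (0 < h l 0) && (G k l == 1)].
    apply: contraT; rewrite negb_exists => /forallP nGk.
    have h0E l : h l 0 = 0.
      have /eqP : \sum_l h l 0 * (1 - G k l) = 0.
        under eq_bigr do rewrite mulrBr mulr1 [_ * G _ _]mulrC.
        by move: ck1; rewrite sumrB h1 mxE => ->; rewrite subrr.
      rewrite psumr_eq0 => [|j _]; last by rewrite mulr_ge0 // subr_ge0.
      move/allP/(_ l (mem_index_enum _)); rewrite /= mulf_eq0 subr_eq0 => /orP[/eqP //|].
      rewrite eq_sym => Gk1; have := nGk l; rewrite Gk1 andbT -leNgt => hl.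
      by apply/eqP; rewrite eq_le hl h0.
    by move: h1 => /eqP; rewrite big1 // eq_sym oner_eq0.
  case/andP=> _ /eqP Gk1; exists l.
  have := in_simplex_eq1 (k := k) (sG l); rewrite mxE => /(_ Gk1) Gl.
  by rewrite [in LHS]defV colE -mulmxA -colE Gl -colE.
have f_inj : injective f.
  move=> i j fij; apply/eqP; apply: contraT => ij.
  case: (extW i); exists (delta_mx j 0); split; first exact: in_simplex_delta.
  by split; [rewrite mxE (negPf ij) | rewrite -colE -!fP fij].
(* The map [f] sends a column of [W] to its position in [V], so column [l] of [V] is column [f^-1 l]
   of [W]. *)
exists (perm f_inj); rewrite -[perm f_inj]invgK -col_permE.
apply/matrixP => i l; rewrite mxE.
have /colP/(_ i) := fP ((perm f_inj)^-1%g l); rewrite !mxE => <-.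
by rewrite -[f _](permE f_inj) permKV.
Qed.

End FacetBasedUniqueness.

Unset Implicit Arguments.

Theorem theorem1 (R : realFieldType) (m n r : nat) (X : 'M[R]_(m, n))
  (W What : 'M[R]_(m, r)) (H Hhat : 'M[R]_(r, n)) (s shat : nat) :
  nonneg_mx X -> nonneg_mx H -> nonneg_mx Hhat ->
  X = W *m H -> FBC X W H s ->
  X = What *m Hhat -> FBC X What Hhat shat ->
  exists Pi : 'S_r, What = W *m perm_mx Pi.
Proof.
move=> _ _ _ defX fbc defX' fbc'.
have [extW [sH _]] := fbc; have [_ [sH' _]] := fbc'.
(* The columns of each factor lie in conv(X), which the simplex columns of [H] and [Hhat] place
   inside the hull of the other factor. *)
apply: convex_position_perm => // k.
  have [h [sh ->]] := FBC_cols_in_conv defX fbc k.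
  by exists (Hhat *m h); rewrite defX' mulmxA; split=> //; apply: in_simplex_mulmx.
have [h [sh ->]] := FBC_cols_in_conv defX' fbc' k.
by exists (H *m h); rewrite defX mulmxA; split=> //; apply: in_simplex_mulmx.
Qed.
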